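(* Consider the controlled-predictor MDP $(\mathcal{P}(\mathbb{X}),\mathcal{Q}\times\mathcal{H},P(d\pi'\mid\pi,Q,\eta),\tilde c)$ and its finite approximations $\mathrm{MDP}_n$ described in the context, with discount factor $\beta\in(0,1)$. For each $n$ let $\hat\gamma_n^*:\mathcal{P}_n(\mathbb{X})\to\mathcal{Q}\times\mathcal{H}$ be an optimal (discounted cost) stationary policy for $\mathrm{MDP}_n$, and let $\tilde\gamma_n^*(\pi)=\hat\gamma_n^*(\rho(\pi))$, $\pi\in\mathcal{P}(\mathbb{X})$, be its extension to the original MDP. Then for all $\pi_0\in\mathcal{P}(\mathbb{X})$, $$\lim_{n\to\infty}\big|J_\beta(\pi_0,\tilde\gamma_n^* )-J_\beta(\pi_0)\big|=0.$$
   Context: $\mathbb{X}$ (states), $\mathbb{U}$ (actions), $\mathbb{M}$ (channel symbols) are finite nonempty sets, $P(x'\mid x,u)$ is a transition kernel on $\mathbb{X}$ given $\mathbb{X}\times\mathbb{U}$ and $c:\mathbb{X}\times\mathbb{U}\to\mathbb{R}$ is a cost. $\mathcal{Q}=\{Q:\mathbb{X}\to\mathbb{M}\}$, $\mathcal{H}=\{\eta:\mathcal{Q}\times\mathbb{M}\to\mathbb{U}\}$; $\mathcal{P}(\mathbb{X})$ is the set of probability measures on $\mathbb{X}$ with the weak topology. Controlled-predictor MDP: state space $\mathcal{P}(\mathbb{X})$, action space $\mathcal{Q}\times\mathcal{H}$, transition kernel $P(D\mid\pi,Q,\eta)=\sum_{q\in\mathbb{M}}\pi(Q^{-1}(q))\mathbf{1}\{F(\pi,Q,\eta,q)\in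 D\}$ with $$F(\pi,Q,\eta,q)(x')=\frac{1}{\pi(Q^{-1}(q))}\sum_{x\in Q^{-1}(q)}P(x'\mid x,\eta(Q,q))\pi(x)\quad\text{if }\pi(Q^{-1}(q))>0$$ (arbitrary otherwise), and stage cost $\tilde c(\pi,Q,\eta)=\sum_x\pi(x)c(x,\eta(Q,Q(x)))$. For a policy $\gamma$, $J_\beta(\pi_0,\gamma)=E^\gamma_{\pi_0}[\sum_{k\ge0}\beta^k\tilde c(\pi_k,Q_k,\eta_k)]$, and $J_\beta(\pi_0)=\inf_\gamma J_\beta(\pi_0,\gamma)$ is the optimal cost. (This equals the optimal discounted cost of the underlying joint coding-control problem over a noiseless channel.) Finite approximation: $\mathcal{P}_n(\mathbb{X})=\{\hat\pi\in\mathcal{P}(\mathbb{X}):\hat\pi=[k_1/n,\dots,k_{|\mathbb{X}|}/n],\ k_i\in\{0,\dots,n\}\}$. $\rho(\pi)=\arg\min_{\hat\pi\in\mathcal{P}_n(\mathbb{X})}d(\pi,\hat\pi)$ is the nearest-neighbour map (ties broken measurably), with $d$ a metric on $\mathcal{P}(\mathbb{X})$ inducing its topology (say the $L^1$ distance); $\rho$ depends on $n$. The bins are $B_{n,i}=\rho^{-1}(\hat\pi_{n,i})$, where $\hat\pi_{n,i}$ enumerates $\mathcal{P}_n(\mathbb{X})$. Fix a probability measure $\kappa$ on $\mathcal{P}(\mathbb{X})$ with $\kappa(B_{n,i})>0$ for all $n,i$. Define $$c_n(\hat\pi_{n,i},Q,\eta)=\int_{B_{n,i}}\tilde c(\pi,Q,\eta)\frac{\kappa(d\pi)}{\kappa(B_{n,i})},\qquad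 P_n(\hat\pi_{n,j}\mid\hat\pi_{n,i},Q,\eta)=\int_{B_{n,i}}P(B_{n,j}\mid\pi,Q,\eta)\frac{\kappa(d\pi)}{\kappa(B_{n,i})}.$$ $\mathrm{MDP}_n=(\mathcal{P}_n(\mathbb{X}),\mathcal{Q}\times\mathcal{H},P_n,c_n)$, with the same discount factor $\beta$. *)

(* Defs.v *)
From HB Require Import structures.
From mathcomp Require Import all_boot all_order all_algebra.
From mathcomp Require Import all_classical all_reals all_analysis.
Set Implicit Arguments.
Unset Strict Implicit.
Unset Printing Implicit Defensive.
Import Order.TTheory GRing.Theory Num.Theory.
Import numFieldNormedType.Exports.
Local Open Scope classical_set_scope.
Local Open Scope ring_scope.

(* Finite nonempty sets: measurable types are pointed, so the nonemptiness of
   the alphabets is carried by a distinguished point. *)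
#[short(type="pointedFinType")]
HB.structure Definition PointedFinite := {T of Finite T & Pointed T}.

(* The set P(T) of probability measures on a finite type T, as mass functions. *)
Section pdist.
Context (R : realType) (T : finType).

Record pdist := PDist {
  pmass :> {ffun T -> R};
  pdistP : [forall x, 0 <= pmass x] && (\sum_x pmass x == 1) }.

HB.instance Definition _ := [isSub for pmass].
HB.instance Definition _ := [Choice of pdist by <:].

Lemma pmass_ge0 (p : pdist) x : 0 <= p x.
Proof. by case: p => p /= /andP[/forallP]. Qed.

Lemma pdirac_subproof (a : T) :
  let f := [ffun x => (x == a)%:R : R] in
  [forall x, 0 <= f x] && (\sum_x f x == 1).
Proof.
apply/andP; split; first by apply/forallP => x; rewrite ffunE ler0n.
rewrite (bigD1 a) //= ffunE eqxx big1 ?addr0 // => x /negbTE xa.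
by rewrite ffunE xa.
Qed.
Definition pdirac (a : T) : pdist := PDist (pdirac_subproof a).

(* T being finite, every real function on T is bounded and continuous, so the
   weak topology is that of pointwise convergence of the masses. *)
HB.instance Definition _ := Topological.copy pdist
  (initial_topology (fun p : pdist => (p : T -> R) : {ptws T -> R})).

(* d is a metric that induces the topology of P(T). *)
Definition metrizes (d : pdist -> pdist -> R) : Prop :=
  [/\ forall p q, d p q = 0 <-> p = q,
      forall p q, d p q = d q p,
      forall p q r, d p r <= d p q + d q r
    & forall A : set pdist, open A <->
        forall p, A p -> exists2 e, 0 < e & forall q, d p q < e -> A q].

End pdist.

HB.instance Definition _ (R : realType) (T : pointedFinType) :=
  isPointed.Build (pdist R T) (pdirac R point).

(* P(T) carries its Borel sigma-algebra. *)
HB.instance Definition _ (R : realType) (T : pointedFinType) :=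
  Measurable.copy (pdist R T) (g_sigma_algebraType (@open (pdist R T))).

(* The measure sum_i w_i delta_{y_i}. *)
Section wdirac.
Local Open Scope ereal_scope.
Context d (S : measurableType d) (R : realType) (I : finType).
Variables (w : I -> {nonneg R}) (y : I -> S).

Definition wdirac (D : set S) : \bar R :=
  \sum_(i : I) (w i)%:num%:E * \d_(y i) D.

Let wdirac0 : wdirac set0 = 0.
Proof. by rewrite /wdirac big1 // => i _; rewrite measure0 mule0. Qed.

Let wdirac_ge0 D : 0 <= wdirac D.
Proof. by apply: sume_ge0 => i _; rewrite mule_ge0 // lee_fin. Qed.

Let wdirac_sigma_additive : semi_sigma_additive wdirac.
Proof.
move=> F mF tF mUF.
rewrite (_ : (fun _ => _) = (fun n => \sum_(i : I)
    \sum_(0 <= k < n) mscale (w i) (\d_(y i)) (F k))); last first.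
  by apply/funext => n; rewrite exchange_big.
apply: cvg_nnesum => i _.
  by near=> n; apply: sume_ge0 => k _; exact: measure_ge0.
exact: (@measure_semi_sigma_additive _ _ _ (mscale (w i) \d_(y i))).
Unshelve. all: by end_near. Qed.

HB.instance Definition _ := isMeasure.Build d S R wdirac
  wdirac0 wdirac_ge0 wdirac_sigma_additive.

End wdirac.

(* Discounted Markov decision processes with finitely many actions. *)
Section mdp.
Context d (S : measurableType d) (A : finType) (R : realType).

Record mdp := Mdp {
  mdp_kernel : S -> A -> {measure set S -> \bar R};
  mdp_cost : S -> A -> R }.

(* Randomized history-dependent policies: g t al ss is the law of the action
   a_t given the past actions al = (a_0,...,a_(t-1)) and the states
   ss = (s_0,...,s_t). *)
Definition policy := forall t, t.-tuple A -> t.+1.-tuple S -> pdist R A.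

(* A is finite, so joint measurability in the history is measurability in the
   states for each sequence of past actions. *)
Definition admissible (g : policy) : Prop := forall t (al : t.-tuple A) (a : A),
  measurable_fun [set: t.+1.-tuple S] (fun ss => g t al ss a).

Definition stationary (f : S -> A) : policy :=
  fun t _ ss => pdirac R (f (tnth ss ord_max)).

Variables (m : mdp) (beta : R).

(* Expectation, conditionally on the history (al, ss) up to time t, of the cost
   c(s_(t+k), a_(t+k)) under g: the integral of the cost against the composition
   of the policy and transition kernels. *)
Fixpoint ecost (g : policy) (k t : nat) (al : t.-tuple A) (ss : t.+1.-tuple S)
    : R :=
  \sum_(a : A) g t al ss a *
    (let s := tnth ss ord_max in
     if k is k'.+1 then
       \int[mdp_kernel m s a]_s'
         ecost g k' (rcons_tuple al a) (rcons_tuple ss s')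
     else mdp_cost m s a).

Definition Jbeta (g : policy) (s0 : S) : R :=
  limn (series (fun k => beta ^+ k * ecost g k [tuple] [tuple s0])).

Definition Jopt (s0 : S) : R :=
  inf [set Jbeta g s0 | g in [set g | admissible g]].

Definition optimal_stationary (f : S -> A) : Prop :=
  forall s0, Jbeta (stationary f) s0 = Jopt s0.

End mdp.

Section predictor_mdp.
Context (R : realType) (X U M : pointedFinType).

Definition quantizer : Type := {ffun X -> M}.
Definition decoder : Type := {ffun quantizer * M -> U}.
HB.instance Definition _ := Finite.on quantizer.
HB.instance Definition _ := Finite.on decoder.
Definition coding_action : Type := (quantizer * decoder)%type.
HB.instance Definition _ := Finite.on coding_action.

(* pi(Q^{-1}(q)) *)
Definition cell_mass (p : pdist R X) (Q : quantizer) (q : M) : R :=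
  \sum_(x | Q x == q) p x.

Lemma cell_mass_ge0 p Q q : 0 <= cell_mass p Q q.
Proof. by apply: sumr_ge0 => x _; exact: pmass_ge0. Qed.

(* F is unconstrained on cells of zero mass. *)
Definition predictor_update (P : X -> U -> pdist R X)
    (F : pdist R X -> coding_action -> M -> pdist R X) : Prop :=
  forall p (a : coding_action) q, 0 < cell_mass p a.1 q ->
  forall x', F p a q x' =
    (cell_mass p a.1 q)^-1 * \sum_(x | a.1 x == q) P x (a.2 (a.1, q)) x' * p x.

Definition predictor_kernel (F : pdist R X -> coding_action -> M -> pdist R X)
    (p : pdist R X) (a : coding_action)
    : {measure set (pdist R X) -> \bar R} :=
  wdirac (fun q => NngNum (cell_mass_ge0 p a.1 q)) (F p a).

Definition predictor_cost (c : X -> U -> R) (p : pdist R X)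
    (a : coding_action) : R :=
  \sum_x p x * c x (a.2 (a.1, a.1 x)).

Definition predictor_mdp (c : X -> U -> R)
    (F : pdist R X -> coding_action -> M -> pdist R X)
    : mdp (pdist R X) coding_action R :=
  Mdp (predictor_kernel F) (predictor_cost c).

End predictor_mdp.

(* P_(n.+1)(X): the counts (k_x)_x with sum n.+1, standing for the measure with
   masses k_x / n.+1; the shift of n excludes the denominator 0. *)
Section grid.
Context (R : realType) (X : pointedFinType) (n : nat).

Record grid := Grid {
  gcount :> {ffun X -> 'I_n.+2};
  gridP : (\sum_x gcount x == n.+1)%N }.

HB.instance Definition _ := [isSub for gcount].
HB.instance Definition _ := [Finite of grid by <:].

Lemma grid_point_subproof :
  let f := [ffun x : X => if x == point then ord_max else ord0 : 'I_n.+2] in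
  (\sum_x f x == n.+1)%N.
Proof.
rewrite /= (bigD1 point) //= ffunE eqxx big1 ?addn0 // => x /negbTE xp.
by rewrite ffunE xp.
Qed.
HB.instance Definition _ := isPointed.Build grid (Grid grid_point_subproof).
HB.instance Definition _ := @isMeasurable.Build default_measure_display
  grid discrete_measurable discrete_measurable0
  discrete_measurableC discrete_measurableU.

Lemma grid_pdist_subproof (k : grid) :
  let f := [ffun x => (k x)%:R / n.+1%:R : R] in
  [forall x, 0 <= f x] && (\sum_x f x == 1).
Proof.
apply/andP; split; first by apply/forallP => x; rewrite ffunE divr_ge0.
under eq_bigr do rewrite ffunE.
by rewrite -mulr_suml -natr_sum (eqP (gridP k)) divff // pnatr_eq0.
Qed.
Definition grid_pdist (k : grid) : pdist R X := PDist (grid_pdist_subproof k).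

(* rho is a nearest-neighbour map for d, with ties broken measurably. *)
Definition nearest_neighbour (d : pdist R X -> pdist R X -> R)
    (rho : pdist R X -> grid) : Prop :=
  measurable_fun [set: pdist R X] rho /\
  forall p k, d p (grid_pdist (rho p)) <= d p (grid_pdist k).

Definition bin (rho : pdist R X -> grid) (i : grid) : set (pdist R X) :=
  rho @^-1` [set i].

End grid.

Section finite_mdp.
Context (R : realType) (X U M : pointedFinType).
Variables (c : X -> U -> R)
  (F : pdist R X -> coding_action X U M -> M -> pdist R X).
Variables (n : nat) (rho : pdist R X -> grid X n).
Variable kappa : probability (pdist R X) R.

Definition finite_cost (i : grid X n) (a : coding_action X U M) : R :=
  (\int[kappa]_(p in bin rho i) predictor_cost c p a)
    / fine (kappa (bin rho i)).

(* P_n(j | i, a) *)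
Definition finite_trans (i : grid X n) (a : coding_action X U M)
    (j : grid X n) : R :=
  (\int[kappa]_(p in bin rho i) fine (predictor_kernel F p a (bin rho j)))
    / fine (kappa (bin rho i)).

Lemma finite_trans_ge0 i a j : 0 <= finite_trans i a j.
Proof.
rewrite divr_ge0 ?fine_ge0 //; apply: integral_ge0 => p _.
by rewrite lee_fin fine_ge0.
Qed.

Definition finite_mdp : mdp (grid X n) (coding_action X U M) R :=
  Mdp (fun i a => wdirac (fun j => NngNum (finite_trans_ge0 i a j)) id)
      finite_cost.

End finite_mdp.

(* Main.v *)
Require Import Defs.
From HB Require Import structures.
From mathcomp Require Import all_boot all_order all_algebra.
From mathcomp Require Import all_classical all_reals all_analysis.
From mathcomp Require Import measurable_realfun.
From mathcomp Require Import ring lra.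
Set Implicit Arguments.
Unset Strict Implicit.
Unset Printing Implicit Defensive.
Import Order.TTheory GRing.Theory Num.Theory.
Import numFieldNormedType.Exports.
Local Open Scope classical_set_scope.
Local Open Scope ring_scope.

(** The proof compares both models with one well-behaved function W that almost
    solves the Bellman equation of the predictor MDP.

    Regularity. The predictor on a cell, multiplied by the mass of the cell, is
    a linear image of the prior.  Hence the Bellman operator preserves the
    functions V whose degree-one homogeneous extension [s * p |-> s * V p] is
    Lipschitz for the L1 norm on the cone of measures, with the constant
    [L = |c| / (1 - beta)] ([qval_hlip]).  Value iteration started at 0 thus
    yields, for every eta, a function W that is L-Lipschitz and satisfies the
    Bellman equation up to eta ([value_iterate_hlip], [value_iterate_dist]).

    Approximate dynamic programming. A bounded function that satisfies the
    one-step optimality inequality, or the one-step evaluation equation of a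
    policy, up to e bounds the corresponding discounted cost up to
    [e / (1 - beta)] ([Jbeta_error]).

    Discretization. The simplex is compact, so d is uniformly equivalent to the
    L1 distance ([metrizes_uniform]) and the bins shrink uniformly in L1
    ([grid_mesh]).  Averaging over a bin of L1-diameter O(delta) then changes
    the one-step values of W by O(L * delta) only ([finite_qval_dist]), so that
    W sampled on the grid almost solves the Bellman equation of the finite MDP
    and is close to its optimal cost ([finite_Jopt_dist]).  The optimal finite
    policy satisfies its own evaluation equation exactly, hence it is almost
    greedy for W on every bin; transported back, its extension is almost greedy
    for W on the whole simplex ([extended_policy_gap]).  Its cost and the
    optimal cost are therefore both close to W.

    All transition laws are finite sums of point masses, and points are
    measurable, so that integrals against them are finite sums for every
    integrand ([Rintegral_wdirac]).  The two MDPs are then treated alike, and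
    expected costs along arbitrary histories are handled by finite algebra. *)

(** * Integration against finite sums of point masses *)

Section integral_wdirac.
Context d (S : measurableType d) (R : realType).
Local Open Scope ereal_scope.

(** The integral of a nonnegative function is the supremum of the integrals of the
    simple functions below it, and this supremum is monotone for arbitrary
    functions. *)
Lemma ge0_le_integral_nonmeasurable (mu : {measure set S -> \bar R})
    (f g : S -> \bar R) :
  (forall x, 0 <= f x) -> (forall x, f x <= g x) ->
  \int[mu]_x f x <= \int[mu]_x g x.
Proof.
move=> f0 fg; have g0 x : 0 <= g x by exact: le_trans (fg x).
rewrite !ge0_integralTE //; apply: ge_ereal_sup => _ [h hf <-].
by apply: ereal_sup_ubound; exists h => // x; exact: le_trans (fg x).
Qed.

Context (I : finType) (w : I -> {nonneg R}) (y : I -> S).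

Lemma ge0_integral_wdirac_measurable (f : S -> \bar R) :
  measurable_fun setT f -> (forall x, 0 <= f x) ->
  \int[wdirac w y]_x f x = \sum_(i : I) (w i)%:num%:E * f (y i).
Proof.
move=> mf f0.
pose m_ (k : nat) : {measure set S -> \bar R} :=
  if insub k is Some j then mscale (w (@enum_val I I j)) \d_(y (enum_val j))
  else mzero.
have mE (j : 'I_#|I|) : m_ j = mscale (w (enum_val j)) \d_(y (enum_val j)).
  by rewrite /m_ valK.
rewrite (@eq_measure_integral _ _ _ _ (msum m_ #|I|)) => [|A mA _]; last first.
  rewrite /= /msum /wdirac (reindex (@enum_val I I)) /=; last first.
    by exists enum_rank => i _; rewrite ?enum_valK ?enum_rankK.
  by apply: eq_big => j //; rewrite ?mE.
rewrite ge0_integral_measure_sum // [RHS](reindex (@enum_val I I)) /=; last first.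
  by exists enum_rank => i _; rewrite ?enum_valK ?enum_rankK.
apply: eq_big => // j _; rewrite mE ge0_integral_mscale // integral_dirac //.
by rewrite diracT mul1e.
Qed.

Hypothesis m1 : forall x : S, measurable [set x].

(** An arbitrary integrand f lies between two measurable functions that agree with
    f on the finite set of atoms: off the atoms, one is 0 and the other +oo. *)
Lemma ge0_integral_wdirac (f : S -> \bar R) : (forall x, 0 <= f x) ->
  \int[wdirac w y]_x f x = \sum_(i : I) (w i)%:num%:E * f (y i).
Proof.
move=> f0.
pose Y := [set` codom y].
have Yy i : Y (y i) by exact: codom_f.
have mY (B : set S) : B `<=` Y -> measurable B.
  move=> BY; apply: countable_measurable => //.
  exact/finite_set_countable/(sub_finite_set BY)/finite_seq.
pose g (z : \bar R) x := if x \in Y then f x else z.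
have mg z : measurable_fun setT (g z).
  move=> _ B mB; rewrite setTI.
  rewrite (_ : _ @^-1` B = (Y `&` f @^-1` B) `|` (~` Y `&` cst z @^-1` B)).
    apply: measurableU; first by apply: mY => x [].
    apply: measurableI; first by apply: measurableC; exact: mY.
    rewrite preimage_cst; case: ifP => _; exact: measurableT || exact: measurable0.
  apply/seteqP; split => x /=; rewrite /g.
    by case: ifPn => [/set_mem|/negP Yx]; [left|right; split => // /mem_set].
  by case=> [] [Yx]; [rewrite mem_set|rewrite memNset].
have gE z : 0 <= z ->
    \int[wdirac w y]_x g z x = \sum_(i : I) (w i)%:num%:E * f (y i).
  move=> z0; rewrite ge0_integral_wdirac_measurable //; last first.
    by move=> x; rewrite /g; case: ifP.
  by apply: eq_bigr => i _; rewrite /g mem_set.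
apply/eqP; rewrite eq_le; apply/andP; split.
  rewrite -(gE +oo) ?leey //; apply: ge0_le_integral_nonmeasurable => // x.
  by rewrite /g; case: ifP => // _; rewrite leey.
rewrite -(gE 0) //; apply: ge0_le_integral_nonmeasurable => x;
by rewrite /g; case: ifP.
Qed.

Lemma Rintegral_wdirac (f : S -> R) :
  (\int[wdirac w y]_x f x = \sum_(i : I) (w i)%:num * f (y i))%R.
Proof.
rewrite /Rintegral integralE !ge0_integral_wdirac //.
under eq_bigr do rewrite funeposE.
under [X in _ - X]eq_bigr do rewrite funenegE.
under eq_bigr do rewrite -EFin_max -EFinM.
under [X in _ - X]eq_bigr do rewrite -EFinN -EFin_max -EFinM.
rewrite !sumEFin -EFinB /= -sumrB; apply: eq_bigr => i _.
rewrite -mulrBr; congr (_ * _)%R; case: (lerP 0 (f (y i))) => fy.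
  by rewrite max_r ?subr0 // oppr_le0.
by rewrite max_l ?oppr_ge0 ?(ltW fy) // sub0r opprK.
Qed.

End integral_wdirac.

(** * Discounted MDPs with finitely supported transitions *)

Section finitary.
Context d (S : measurableType d) (A : finType) (R : realType).
Variable m : mdp S A R.

(** Stated with all integrands f, so that the integral is a positive linear
    functional on all real functions on S. *)
Definition finitary : Prop := forall s a, exists (I : finType) (w : I -> R)
    (y : I -> S), [/\ forall i, 0 <= w i, \sum_i w i = 1
  & forall f : S -> R,
      \int[mdp_kernel m s a]_x f x = \sum_i w i * f (y i)].

Hypothesis finm : finitary.

Lemma finitary_int_cst s a (k : R) : \int[mdp_kernel m s a]_x k = k.
Proof.
by have [I [w [y [_ w1 ->]]]] := finm s a; rewrite -mulr_suml w1 mul1r.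
Qed.

Lemma finitary_int_sum s a n (b : nat -> R) (f : nat -> S -> R) :
  \int[mdp_kernel m s a]_x (\sum_(k < n) b k * f k x) =
  \sum_(k < n) b k * \int[mdp_kernel m s a]_x f k x.
Proof.
have [I [w [y [_ _ E]]]] := finm s a; rewrite E.
under [RHS]eq_bigr do rewrite E mulr_sumr.
rewrite exchange_big; apply: eq_bigr => i _ /=; rewrite mulr_sumr.
by apply: eq_bigr => k _; rewrite mulrCA.
Qed.

Lemma finitary_intB s a (f g : S -> R) :
  \int[mdp_kernel m s a]_x (f x - g x) =
  \int[mdp_kernel m s a]_x f x - \int[mdp_kernel m s a]_x g x.
Proof.
have [I [w [y [_ _ E]]]] := finm s a; rewrite !E -sumrB.
by apply: eq_bigr => i _; rewrite mulrBr.
Qed.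

Lemma finitary_intZ s a (k : R) (f : S -> R) :
  \int[mdp_kernel m s a]_x (k * f x) = k * \int[mdp_kernel m s a]_x f x.
Proof.
have [I [w [y [_ _ E]]]] := finm s a; rewrite !E mulr_sumr.
by apply: eq_bigr => i _; rewrite mulrCA.
Qed.

Lemma finitary_int_le s a (f g : S -> R) : (forall x, f x <= g x) ->
  \int[mdp_kernel m s a]_x f x <= \int[mdp_kernel m s a]_x g x.
Proof.
move=> fg; have [I [w [y [w0 _ E]]]] := finm s a; rewrite !E.
by apply: ler_sum => i _; exact: ler_wpM2l.
Qed.

Lemma finitary_int_norm s a (f : S -> R) (k : R) : (forall x, `|f x| <= k) ->
  `|\int[mdp_kernel m s a]_x f x| <= k.
Proof.
move=> fk; rewrite ler_norml -{1}(finitary_int_cst s a (- k)).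
rewrite -[X in _ && (_ <= X)](finitary_int_cst s a k).
by apply/andP; split; apply: finitary_int_le => x;
  have := fk x; rewrite ler_norml => /andP[].
Qed.

End finitary.

Section discounted.
Context d (S : measurableType d) (A : finType) (R : realType).
Variables (m : mdp S A R) (beta C : R).
Hypotheses (finm : finitary m) (hbeta : 0 < beta < 1).
Hypothesis costC : forall s a, `|mdp_cost m s a| <= C.

Let beta0 : 0 < beta. Proof. by case/andP: hbeta. Qed.
Let beta1 : 0 < 1 - beta. Proof. by case/andP: hbeta; rewrite subr_gt0. Qed.

(** The right-hand side of the Bellman equation for the action a. *)
Definition qval (V : S -> R) (s : S) (a : A) : R :=
  mdp_cost m s a + beta * \int[mdp_kernel m s a]_x V x.

Lemma qval_norm V s a B : (forall x, `|V x| <= B) ->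
  `|qval V s a| <= C + beta * B.
Proof.
move=> VB; apply: (le_trans (ler_normD _ _)); rewrite lerD //.
rewrite normrM (gtr0_norm beta0) ler_pM2l //; exact: finitary_int_norm.
Qed.

Lemma qvalB V V' s a :
  qval V s a - qval V' s a = beta * \int[mdp_kernel m s a]_x (V x - V' x).
Proof. by rewrite finitary_intB // /qval mulrBr opprD addrACA subrr add0r. Qed.

Lemma qval_dist V V' s a e : (forall x, `|V x - V' x| <= e) ->
  `|qval V s a - qval V' s a| <= beta * e.
Proof.
move=> VV'; rewrite qvalB normrM (gtr0_norm beta0) ler_pM2l //.
exact: finitary_int_norm.
Qed.

Lemma policy_avg (p : pdist R A) (f : A -> R) (k : R) :
  (forall a, 0 < p a -> f a <= k) -> \sum_a p a * f a <= k.
Proof.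
move=> fk; have /andP[_ /eqP p1] := pdistP p.
rewrite -[leRHS]mul1r -p1 mulr_suml; apply: ler_sum => a _.
have := pmass_ge0 p a; rewrite le_eqVlt => /predU1P[<-|pa]; first by rewrite !mul0r.
by rewrite ler_pM2l // fk.
Qed.

Definition partial_cost (g : policy S A R) N t (al : t.-tuple A)
    (ss : t.+1.-tuple S) : R :=
  \sum_(k < N) beta ^+ k * ecost m g k al ss.

Lemma partial_costS (g : policy S A R) N t (al : t.-tuple A) (ss : t.+1.-tuple S) :
  partial_cost g N.+1 al ss =
  \sum_a g t al ss a *
    qval (fun s' => partial_cost g N (rcons_tuple al a) (rcons_tuple ss s'))
         (tnth ss ord_max) a.
Proof.
rewrite /partial_cost big_ord_recl expr0 mul1r /=.
under [RHS]eq_bigr do rewrite /qval mulrDr.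
rewrite big_split /=; congr (_ + _).
under eq_bigr do rewrite mulr_sumr.
rewrite exchange_big; apply: eq_bigr => a _ /=.
rewrite (finitary_int_sum finm _ _ _ (fun k => beta ^+ k)
  (fun k s' => ecost m g k (rcons_tuple al a) (rcons_tuple ss s'))).
rewrite !mulr_sumr; apply: eq_bigr => k _.
by rewrite exprS mulrCA !mulrA.
Qed.

Lemma ecost_norm (g : policy S A R) k t (al : t.-tuple A) (ss : t.+1.-tuple S) :
  `|ecost m g k al ss| <= C.
Proof.
elim: k t al ss => [|k IH] t al ss /=; apply: (le_trans (ler_norm_sum _ _ _));
  under eq_bigr do rewrite normrM (ger0_norm (pmass_ge0 _ _)).
  by apply: policy_avg => a _.
apply: policy_avg => a _; exact: finitary_int_norm.
Qed.

Lemma cvg_Jbeta (g : policy S A R) s0 :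
  (fun N => partial_cost g N [tuple] [tuple s0]) @ \oo --> Jbeta m beta g s0.
Proof.
have -> : (fun N => partial_cost g N [tuple] [tuple s0]) =
    series (fun k => beta ^+ k * ecost m g k [tuple] [tuple s0]).
  by apply/funext => N; rewrite /series /= big_mkord.
apply: normed_cvg; apply: (@series_le_cvg _ _ (geometric C beta)).
- by move=> n /=; exact: normr_ge0.
- move=> n; rewrite /= mulr_ge0 ?exprn_ge0 ?(ltW beta0) //.
  exact: le_trans (normr_ge0 _) (ecost_norm g 0 [tuple] [tuple s0]).
- move=> n /=; rewrite normrM mulrC (ger0_norm (exprn_ge0 _ (ltW beta0))).
  by rewrite ler_wpM2r ?exprn_ge0 ?(ltW beta0) // ecost_norm.
- apply: is_cvg_geometric_series; rewrite gtr0_norm //.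
  by case/andP: hbeta.
Qed.

(** The one-step defects e add up to at most [e + beta e + ... <= e / (1 - beta)],
    and replacing the tail of the cost after N stages by W changes it by at most
    [beta ^+ N * B].  The sign sg, equal to 1 or -1 in the applications, gives
    the lower and the upper bounds on the cost at once. *)
Lemma partial_cost_error (g : policy S A R) (W : S -> R) (B sg e : R) :
  (forall s, `|W s| <= B) -> 0 <= e ->
  (forall t (al : t.-tuple A) (ss : t.+1.-tuple S) a, 0 < g t al ss a ->
    sg * (W (tnth ss ord_max) - qval W (tnth ss ord_max) a) <= e) ->
  forall N t (al : t.-tuple A) (ss : t.+1.-tuple S),
  sg * (W (tnth ss ord_max) - partial_cost g N al ss) <=
    e / (1 - beta) + beta ^+ N * (`|sg| * B).
Proof.
move=> WB e0 We; elim => [|N IH] t al ss.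
  rewrite /partial_cost big_ord0 subr0 mul1r.
  rewrite (le_trans (ler_norm _)) // normrM -[leLHS]add0r lerD //.
    by rewrite divr_ge0 // ltW.
  by rewrite ler_wpM2l.
rewrite partial_costS; set s := tnth ss ord_max.
set K := `|sg| * B; pose V a s' :=
  partial_cost g N (rcons_tuple al a) (rcons_tuple ss s').
have -> : sg * (W s - \sum_a g t al ss a * qval (V a) s a) =
    \sum_a g t al ss a * (sg * (W s - qval (V a) s a)).
  have /andP[_ /eqP p1] := pdistP (g t al ss).
  rewrite -{1}[W s]mul1r -p1 mulr_suml -sumrB mulr_sumr.
  by apply: eq_bigr => a _; rewrite -mulrBr mulrCA.
apply: policy_avg => a ga.
rewrite -(subrK (qval W s a) (W s)) -addrA mulrDr qvalB mulrCA -finitary_intZ //.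
have -> : e / (1 - beta) + beta ^+ N.+1 * K =
    e + beta * (e / (1 - beta) + beta ^+ N * K).
  by rewrite exprS; field; rewrite gt_eqF.
apply: lerD; first exact: (We t al ss).
rewrite (ler_pM2l beta0) -[leRHS](finitary_int_cst finm s a).
apply: finitary_int_le => // s'.
have := IH _ (rcons_tuple al a) (rcons_tuple ss s').
by rewrite (tnth_nth s') /= nth_rcons size_tuple ltnn eqxx.
Qed.

(** Only the actions to which g gives positive probability are constrained: a
    bound over all actions gives bounds valid for every policy, and a bound at
    the action f s evaluates the stationary policy f. *)
Lemma Jbeta_error (g : policy S A R) (W : S -> R) (B sg e : R) s0 :
  (forall s, `|W s| <= B) -> 0 <= e ->
  (forall t (al : t.-tuple A) (ss : t.+1.-tuple S) a, 0 < g t al ss a ->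
    sg * (W (tnth ss ord_max) - qval W (tnth ss ord_max) a) <= e) ->
  sg * (W s0 - Jbeta m beta g s0) <= e / (1 - beta).
Proof.
move=> WB e0 We.
pose l N := sg * (W s0 - partial_cost g N [tuple] [tuple s0]).
pose u N := e / (1 - beta) + beta ^+ N * (`|sg| * B).
have lJ : l @ \oo --> sg * (W s0 - Jbeta m beta g s0).
  by apply: cvgMr; apply: cvgB; [exact: cvg_cst|exact: cvg_Jbeta].
have uJ : u @ \oo --> e / (1 - beta).
  rewrite -[X in _ --> X]addr0 -[X in _ --> _ + X](mul0r (`|sg| * B)).
  apply: cvgD; first exact: cvg_cst.
  apply: cvgMl; apply: cvg_expr; rewrite gtr0_norm //.
  by case/andP: hbeta.
apply: (ler_cvg_to lJ uJ); apply: nearW => N; rewrite /l /u.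
have := partial_cost_error WB e0 We N [tuple] [tuple s0].
by rewrite (tnth_nth s0).
Qed.

Lemma Jbeta_lower (g : policy S A R) (W : S -> R) (B e : R) s0 :
  (forall s, `|W s| <= B) -> 0 <= e ->
  (forall s a, W s - qval W s a <= e) ->
  W s0 - e / (1 - beta) <= Jbeta m beta g s0.
Proof.
move=> WB e0 We; have h : 1 * (W s0 - Jbeta m beta g s0) <= e / (1 - beta).
  by apply: (@Jbeta_error g W B 1 e s0 WB e0) => *; rewrite mul1r.
by rewrite lerBlDr -lerBlDl -[leLHS]mul1r.
Qed.

Lemma Jbeta_stationary_error (f : S -> A) (W : S -> R) (B e : R) s0 :
  (forall s, `|W s| <= B) -> (forall s, `|W s - qval W s (f s)| <= e) ->
  `|W s0 - Jbeta m beta (stationary R f) s0| <= e / (1 - beta).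
Proof.
move=> WB We; have e0 : 0 <= e := le_trans (normr_ge0 _) (We s0).
have supp (ss : S) a : 0 < pdirac R (f ss) a -> a = f ss.
  by rewrite /= ffunE; case: eqP => // _; rewrite ltxx.
rewrite ler_norml lerNl -mulN1r -[X in _ && (X <= _)]mul1r.
apply/andP; split; apply: (Jbeta_error s0 WB e0) => t al ss a /supp ->.
  by rewrite mulN1r lerNl; have := We (tnth ss ord_max); rewrite ler_norml => /andP[].
by rewrite mul1r; have := We (tnth ss ord_max); rewrite ler_norml => /andP[].
Qed.

Lemma Jbeta_norm (g : policy S A R) s0 : `|Jbeta m beta g s0| <= C / (1 - beta).
Proof.
have C0 := le_trans (normr_ge0 _) (ecost_norm g 0 [tuple] [tuple s0]).
have z (s : S) : `|cst 0 s : R| <= 0 by rewrite /= normr0.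
have q s a : qval (cst 0) s a = mdp_cost m s a.
  by rewrite /qval (finitary_int_cst finm s a 0) mulr0 addr0.
rewrite ler_norml lerNl; apply/andP; split.
  have := @Jbeta_error g (cst 0) 0 1 C s0 z C0; rewrite mul1r sub0r; apply.
  move=> t al ss a _; rewrite q mul1r sub0r (le_trans _ (costC (tnth ss ord_max) a)) //.
  by rewrite -normrN ler_norm.
have := @Jbeta_error g (cst 0) 0 (-1) C s0 z C0; rewrite mulN1r sub0r opprK; apply.
move=> t al ss a _; rewrite q mulN1r sub0r opprK.
exact: le_trans (ler_norm _) (costC (tnth ss ord_max) a).
Qed.

Lemma Jopt_le (g : policy S A R) s0 : admissible g -> Jopt m beta s0 <= Jbeta m beta g s0.
Proof.
move=> adg; apply: ge_inf; last by exists g.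
exists (- (C / (1 - beta))) => _ [g' _ <-].
by have := Jbeta_norm g' s0; rewrite ler_norml => /andP[].
Qed.

Lemma Jopt_lower (W : S -> R) (B e : R) s0 : (exists g : policy S A R, admissible g) ->
  (forall s, `|W s| <= B) -> 0 <= e -> (forall s a, W s - qval W s a <= e) ->
  W s0 - e / (1 - beta) <= Jopt m beta s0.
Proof.
move=> [g adg] WB e0 We; apply: lb_le_inf; first by exists (Jbeta m beta g s0); exists g.
by move=> _ [g' _ <-]; exact: Jbeta_lower WB e0 We.
Qed.

(** By the Markov property, the expected cost of a stage under a stationary policy
    depends on the history through the current state only; the recursion on
    partial costs is then passed to the limit in the finite sum over successor
    states. *)
Lemma Jbeta_stationary_fixpoint f s : let V := Jbeta m beta (stationary R f) in
  V s = qval V s (f s).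
Proof.
move=> V; have dirac_sum (h : A -> R) a : \sum_b pdirac R a b * h b = h a.
  rewrite (bigD1 a) //= ffunE eqxx mul1r big1 ?addr0 // => b /negbTE ba.
  by rewrite ffunE ba mul0r.
have last_rcons t (ss : t.-tuple S) s' : tnth (rcons_tuple ss s') ord_max = s'.
  by rewrite (tnth_nth s') /= nth_rcons size_tuple ltnn eqxx.
have markov k : forall t (al : t.-tuple A) (ss : t.+1.-tuple S),
    ecost m (stationary R f) k al ss =
    ecost m (stationary R f) k [tuple] [tuple tnth ss ord_max].
  elim: k => [|k IH] t al ss /=; rewrite !dirac_sum !(tnth_nth s) //=.
  by apply: eq_Rintegral => s' _; rewrite IH [RHS]IH !last_rcons.
pose p N s' := partial_cost (stationary R f) N [tuple] [tuple s'].
have pS N : p N.+1 s = qval (p N) s (f s).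
  rewrite /p partial_costS dirac_sum (tnth_nth s) /= /qval; congr (_ + _ * _).
  apply: eq_Rintegral => s' _; apply: eq_bigr => k _.
  by rewrite markov last_rcons.
have h1 : (fun N => p N.+1 s) @ \oo --> V s.
  by have := @cvg_Jbeta (stationary R f) s; rewrite -cvg_shiftS.
have [I [w [y [_ _ E]]]] := finm s (f s).
have h2 : (fun N => p N.+1 s) @ \oo --> qval V s (f s).
  under eq_fun do rewrite pS /qval E.
  rewrite /qval E; apply: cvgD; first exact: cvg_cst.
  apply: cvgMr; apply: cvg_big => [|i _]; first exact: add_continuous.
  by apply: cvgMr; exact: cvg_Jbeta.
exact: cvg_unique h1 h2.
Qed.

Lemma stationary_admissible (f : S -> A) :
  (forall a, measurable [set s | f s = a]) -> admissible (stationary R f).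
Proof.
move=> mf t al a _ B mB; rewrite setTI.
pose D := [set ss : t.+1.-tuple S | f (tnth ss ord_max) = a].
have mD : measurable D.
  rewrite -[D]setTI.
  exact: (@measurable_tnth _ S t.+1 ord_max) (@measurableT _ _) _ (mf a).
rewrite (_ : _ @^-1` B = (D `&` cst 1 @^-1` B) `|` (~` D `&` cst 0 @^-1` B)).
  rewrite !preimage_cst; apply: measurableU; apply: measurableI => //;
    [|exact: measurableC|]; case: ifP => _; exact: measurableT || exact: measurable0.
apply/seteqP; split => ss; rewrite /D /stationary /= ffunE eq_sym.
  by case: eqP => fs; [left|right].
by case=> [] [/eqP h]; rewrite ?h // (negbTE h).
Qed.

End discounted.

(** * Value iteration *)

Section value_iteration.
Context d (S : measurableType d) (A : finType) (R : realType).
Variables (m : mdp S A R) (beta C : R) (a0 : A).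
Hypotheses (finm : finitary m) (hbeta : 0 < beta < 1).
Hypothesis costC : forall s a, `|mdp_cost m s a| <= C.

Let beta0 : 0 < beta. Proof. by case/andP: hbeta. Qed.
Let beta1 : 0 < 1 - beta. Proof. by case/andP: hbeta; rewrite subr_gt0. Qed.

Definition greedy (V : S -> R) (s : S) : A :=
  [arg min_(a < a0) qval m beta V s a]%O.

Definition bellman (V : S -> R) (s : S) : R := qval m beta V s (greedy V s).

Lemma bellman_le V s a : bellman V s <= qval m beta V s a.
Proof. by rewrite /bellman /greedy; case: arg_minP => // b _; apply. Qed.

Lemma bellman_dist V V' s e : (forall x, `|V x - V' x| <= e) ->
  `|bellman V s - bellman V' s| <= beta * e.
Proof.
move=> VV'; have q a : `|qval m beta V s a - qval m beta V' s a| <= beta * e.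
  exact: qval_dist.
rewrite ler_distl; apply/andP; split.
  rewrite lerBlDr (le_trans (bellman_le V' s (greedy V s))) //.
  by rewrite -lerBlDl; have := q (greedy V s); rewrite distrC => /(le_trans (ler_norm _)).
rewrite (le_trans (bellman_le V s (greedy V' s))) //.
by rewrite -lerBlDl; have := q (greedy V' s) => /(le_trans (ler_norm _)).
Qed.

Definition value_iterate k : S -> R := iter k bellman (cst 0).

(** The constant solves [C + beta * x = x]. *)
Lemma value_iterate_norm k s : `|value_iterate k s| <= C / (1 - beta).
Proof.
elim: k s => [|k IH] s.
  by rewrite normr0 divr_ge0 ?(ltW beta1) // (le_trans (normr_ge0 _) (costC s a0)).
have -> : C / (1 - beta) = C + beta * (C / (1 - beta)).
  by field; rewrite gt_eqF.
exact: qval_norm.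
Qed.

Lemma value_iterate_dist k s :
  `|value_iterate k s - value_iterate k.+1 s| <= beta ^+ k * C.
Proof.
elim: k s => [|k IH] s.
  rewrite sub0r normrN mul1r; have z (x : S) : `|cst 0 x : R| <= 0 by rewrite normr0.
  by have := qval_norm finm hbeta costC s (greedy (cst 0) s) z; rewrite mulr0 addr0.
by rewrite exprS -mulrA; exact: bellman_dist.
Qed.

End value_iteration.

(** * Topology of the simplex *)

Section simplex_topology.
Context (R : realType) (T : finType).
Implicit Types p q : pdist R T.

Definition l1 p q : R := \sum_x `|p x - q x|.

Lemma l1_sym p q : l1 p q = l1 q p.
Proof. by apply: eq_bigr => x _; rewrite distrC. Qed.

Lemma l1_triangle p q r : l1 p r <= l1 p q + l1 q r.
Proof.
by rewrite -big_split; apply: ler_sum => x _ /=; exact: ler_distD.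
Qed.

Lemma l1_coord p q x : `|p x - q x| <= l1 p q.
Proof. by rewrite /l1 (bigD1 x) //= lerDl sumr_ge0. Qed.

Lemma l1_eq0 p q : l1 p q = 0 <-> p = q.
Proof.
split=> [pq|->]; last by rewrite /l1 big1 // => x _; rewrite subrr normr0.
apply/val_inj/ffunP => x /=; apply/eqP; rewrite -subr_eq0 -normr_eq0.
by rewrite eq_le normr_ge0 andbT -pq l1_coord.
Qed.

Let toptws (p : pdist R T) : {ptws T -> R} := (p : T -> R).

Lemma mass_continuous x : continuous (fun p : pdist R T => p x).
Proof.
move=> p; apply: (@continuous_comp _ _ _ toptws (fun f : {ptws T -> R} => f x)).
  exact: initial_continuous.
exact: (@proj_continuous _ _ x).
Qed.

Lemma l1_continuous p : continuous (l1 p).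
Proof.
move=> q; apply: (@cvg_big _ _ +%R 0 xpredT _ _ (nbhs q)) => [|x _].
  exact: add_continuous.
apply: cvg_norm; apply: cvgB; first exact: cvg_cst.
exact: mass_continuous.
Qed.

(** A neighbourhood in the product topology constrains finitely many coordinates. *)
Lemma ptws_cvg (F : set_system {ptws T -> R}) (g : {ptws T -> R}) :
  Filter F -> (forall x, (fun f : {ptws T -> R} => f x) @ F --> g x) -> F --> g.
Proof.
move=> FF Fg; apply/cvg_sup => x U [V [[W oW <-] Wg] WU].
by apply: filterS WU _; apply: (Fg x); exact: open_nbhs_nbhs.
Qed.

(** An L1 ball is a neighbourhood because the L1 distance is continuous in the
    masses; conversely the filter of L1 balls around p converges pointwise to p. *)
Lemma metrizes_l1 : metrizes l1.
Proof.
split; [exact: l1_eq0|exact: l1_sym|exact: l1_triangle|move=> A; split].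
  move=> oA p Ap.
  pose F := filter_from [set e : R | 0 < e] (fun e => [set q | l1 p q < e]).
  have FF : Filter F.
    apply: filter_from_filter; first by exists 1 => /=.
    move=> e e' /= e0 e'0; exists (Num.min e e') => /=; first by rewrite lt_min e0.
    by move=> q /=; rewrite lt_min => /andP[].
  have cvF x : (fun q : pdist R T => q x) @ F --> p x.
    apply/cvgrPdist_lt => e e0; exists e => // q /= pq.
    by apply: le_lt_trans pq; exact: l1_coord.
  move: oA => [B oB BA].
  have /(_ B) : toptws @ F --> toptws p by exact: ptws_cvg.
  case; first by apply: open_nbhs_nbhs; split => //; move: Ap; rewrite -BA.
  by move=> e /= e0 eB; exists e => // q /eB; rewrite -BA.
move=> h; rewrite openE => p /h[e e0 pe]; rewrite /interior.
have : nbhs p [set q | l1 p q < e].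
  have /cvgrPdist_lt/(_ _ e0) := @l1_continuous p p.
  apply: filterS => q; rewrite (l1_eq0 p p).2 // sub0r normrN.
  exact: le_lt_trans (ler_norm _).
by apply: filterS => q; exact: pe.
Qed.

(** The image of the simplex in the product space lies in the compact cube
    [[0, 1] ^ T]; a cluster point there has nonnegative coordinates, and total
    mass 1 since the total mass is continuous. *)
Lemma compact_pdist : compact [set: pdist R T].
Proof.
have cK : compact [set f : {ptws T -> R} | forall x, `[0, 1]%classic (f x)].
  exact: (@tychonoff T (fun=> R) (fun=> `[0, 1]%classic)
    (fun=> @segment_compact R 0 1)).
move=> F PF _.
have FK : (toptws @ F) [set f : {ptws T -> R} | forall x, `[0, 1]%classic (f x)].
  apply: (@filterE _ F) => p x /=; rewrite in_itv /= pmass_ge0 /=.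
  have /andP[_ /eqP <-] := pdistP p.
  by rewrite (bigD1 x) //= lerDl sumr_ge0 // => y _; exact: pmass_ge0.
have [g [gK gF]] := cK _ _ FK.
have g1 : \sum_x g x = 1.
  apply: contrapT => /eqP; rewrite -subr_eq0 -normr_gt0 => e0.
  have cs : continuous (fun f : {ptws T -> R} => \sum_x f x).
    move=> f; apply: (@cvg_big _ _ +%R 0 xpredT _ _ (nbhs f)) => [|x _].
      exact: add_continuous.
    exact: (@proj_continuous _ _ x).
  have n1 : nbhs g
      [set f : {ptws T -> R} | `|\sum_x g x - \sum_x f x| < `|\sum_x g x - 1|].
    by have /cvgrPdist_lt/(_ _ e0) := cs g.
  have F1 : (toptws @ F) [set f : {ptws T -> R} | \sum_x f x = 1].
    by apply: (@filterE _ F) => p /=; have /andP[_ /eqP] := pdistP p.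
  by have [f [/= -> ]] := gF _ _ F1 n1; rewrite ltxx.
have gP : [forall x, 0 <= finfun g x] && (\sum_x finfun g x == 1).
  under eq_forallb do rewrite ffunE; under eq_bigr do rewrite ffunE.
  rewrite g1 eqxx andbT; apply/forallP => x.
  by have := gK x; rewrite /= in_itv => /andP[].
exists (PDist gP); split => // A B FA [_ [[B' oB' <-] gB' B'B]].
have nB' : nbhs g B'.
  apply: open_nbhs_nbhs; split=> //; rewrite (_ : g = toptws (PDist gP)) //.
  by apply/funext => x; rewrite /toptws /= ffunE.
have F2 : (toptws @ F) (toptws @` A) by apply: (@filterS _ F _ A) => // p Ap; exists p.
have [f [[p Ap <-] B'p]] := gF _ _ F2 nB'.
by exists p; split => //; exact: B'B.
Qed.

(** Heine's argument: around each x some d1-ball of radius r lies in the d2-ball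
    of radius [e / 2]; the radius [r / 2] works at all points d1-close to x, and
    compactness makes it uniform. *)
Lemma metrizes_uniform (d1 d2 : pdist R T -> pdist R T -> R) :
  metrizes d1 -> metrizes d2 -> forall e, 0 < e ->
  exists2 r, 0 < r & forall p q, d1 p q < r -> d2 p q < e.
Proof.
move=> [e1 s1 t1 o1] [e2 s2 t2 o2] e e0.
have ball_open (dd : pdist R T -> pdist R T -> R) :
    (forall p q r, dd p r <= dd p q + dd q r) ->
    (forall A : set (pdist R T), open A <->
        forall p, A p -> exists2 e, 0 < e & forall q, dd p q < e -> A q) ->
    forall x r, open [set q | dd x q < r].
  move=> t o x r; apply/o => p /= xp; exists (r - dd x p); first by rewrite subr_gt0.
  by move=> q; rewrite ltrBrDl; apply: le_lt_trans.
have /compact_near_coveringP/(_ R (0^'+)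
  (fun r p => forall q, d1 p q < r -> d2 p q < e) _) := compact_pdist.
case=> [x _|r r0 h].
  have x2 : [set q | d2 x q < e / 2] x by rewrite /= (e2 x x).2 // divr_gt0.
  have [r r0 xr] := (o1 _).1 (ball_open _ t2 o2 x (e / 2)) x x2.
  exists ([set q | d1 x q < r / 2], [set s | s < r / 2]) => /=.
    split; last by apply: nbhs_right_lt; rewrite divr_gt0.
    apply: open_nbhs_nbhs; split; first exact: ball_open.
    by rewrite /= (e1 x x).2 // divr_gt0.
  move=> [x' s] /= [xx' sr] q x'q.
  have xq : d1 x q < r.
    by apply: le_lt_trans (t1 x x' q) _; rewrite (splitr r) ltrD // (lt_trans x'q).
  have xx'r : d1 x x' < r.
    by apply: lt_trans xx' _; rewrite ltr_pdivrMr // ltr_pMr // ltr1n.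
  apply: le_lt_trans (t2 x' x q) _; rewrite (splitr e) ltrD //; last exact: xr.
  by rewrite s2; exact: xr.
exists (r / 2); first by rewrite divr_gt0.
move=> p q; apply: h => //=.
- rewrite sub0r normrN gtr0_norm ?divr_gt0 //.
  by rewrite ltr_pdivrMr // ltr_pMr // ltr1n.
- by rewrite divr_gt0.
Qed.

End simplex_topology.

(** * Nearest-neighbour quantization of the simplex *)

Section grid_approximation.
Context (R : realType) (X : pointedFinType).
Implicit Types p q : pdist R X.

(** The masses are rounded down to multiples of [1 / n.+1], and the distinguished
    point receives the remainder; its error is at most the sum of the others. *)
Lemma grid_approx n p :
  exists k : grid X n, l1 p (grid_pdist R k) <= 2 * #|X|%:R / n.+1%:R.
Proof.
pose N : R := n.+1%:R; have N0 : 0 < N by rewrite ltr0n.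
pose fl x := Num.truncn (N * p x).
have flP x : (fl x)%:R <= N * p x < (fl x).+1%:R.
  by apply: Num.Theory.truncn_itv; rewrite mulr_ge0 ?pmass_ge0 // ltW.
have err x : `|p x - (fl x)%:R / N| <= N^-1.
  have /andP[h1 h2] := flP x.
  have -> : p x - (fl x)%:R / N = (N * p x - (fl x)%:R) / N.
    by field; rewrite gt_eqF.
  rewrite ger0_norm; last by rewrite divr_ge0 ?subr_ge0 // ltW.
  by rewrite ler_pdivrMr // mulVf ?gt_eqF // lerBlDl natr1 ltW.
pose s := (\sum_(x | x != point) fl x)%N.
have sN : (s <= n.+1)%N.
  have sR : \sum_(x | x != point) (fl x)%:R <= N * \sum_x p x.
    rewrite [in leRHS](bigD1 point) //= mulrDr mulr_sumr.
    rewrite ler_wpDl // ?mulr_ge0 ?pmass_ge0 ?(ltW N0) //.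
    by apply: ler_sum => x _; have /andP[] := flP x.
  have /andP[_ /eqP p1] := pdistP p.
  by rewrite p1 mulr1 -natr_sum ler_nat in sR.
pose kk x := if x == point then (n.+1 - s)%N else fl x.
have kN x : (kk x < n.+2)%N.
  rewrite ltnS /kk; case: eqP => [_|/eqP xp]; first exact: leq_subr.
  by apply: leq_trans sN; rewrite /s (bigD1 x) //= leq_addr.
have kP : (\sum_x [ffun x => inord (kk x) : 'I_n.+2] x == n.+1)%N.
  rewrite (bigD1 point) //= ffunE inordK // {1}/kk eqxx.
  rewrite (_ : (\sum_(i | i != point) _)%N = s) ?subnK // /s.
  by apply: eq_bigr => x /negbTE xp; rewrite ffunE inordK // /kk xp.
exists (Grid kP); rewrite /l1 (bigD1 point) //=.
have gE x : x != point ->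
    p x - [ffun x => ([ffun x => inord (kk x) : 'I_n.+2] x)%:R / N] x =
    p x - (fl x)%:R / N.
  by move=> /negbTE xp; rewrite !ffunE inordK // /kk xp.
have -> : p point - [ffun x => ([ffun x => inord (kk x) : 'I_n.+2] x)%:R / N] point =
    - \sum_(x | x != point) (p x - (fl x)%:R / N).
  rewrite !ffunE inordK // /kk eqxx natrB // sumrB -mulr_suml -natr_sum -/s.
  have /andP[_ /eqP p1] := pdistP p.
  have -> : p point = 1 - \sum_(x | x != point) p x.
    by rewrite -p1 (bigD1 point) //= addrK.
  by rewrite -/N; field; rewrite gt_eqF.
rewrite normrN [X in _ + X](eq_bigr (fun x => `|p x - (fl x)%:R / N|)); last first.
  by move=> x xp; rewrite gE.
have S : \sum_(x | x != point) `|p x - (fl x)%:R / N| <= #|X|%:R / N.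
  rewrite mulr_natl -sumr_const big_mkcond /=.
  apply: ler_sum => x _; case: ifP => _; first exact: err.
  by rewrite invr_ge0 ltW.
rewrite -mulrA mulr2n mulrDl mul1r lerD //.
exact: le_trans (ler_norm_sum _ _ _) S.
Qed.

(** The point of the grid selected by rho is at least as d-close to p as the L1
    approximation of p in the grid, which is d-close by uniform equivalence. *)
Lemma grid_mesh (d : pdist R X -> pdist R X -> R)
    (rho : forall n, pdist R X -> grid X n) :
  metrizes d -> (forall n, nearest_neighbour d (rho n)) -> forall e, 0 < e ->
  \forall n \near \oo, forall p, l1 p (grid_pdist R (rho n p)) < e.
Proof.
move=> hd hrho e e0.
have [r r0 rP] := metrizes_uniform hd (@metrizes_l1 R X) e0.
have [s s0 sP] := metrizes_uniform (@metrizes_l1 R X) hd r0.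
have c0 : 0 < s / (2 * #|X|%:R + 1) by rewrite divr_gt0 // ltr_wpDl // mulr_ge0.
have := near_infty_natSinv_lt (PosNum c0); apply: filterS => n /= nP p.
have [k kP] := grid_approx n p.
apply: rP; apply: le_lt_trans ((hrho n).2 p k) _; apply: sP.
apply: le_lt_trans kP _; rewrite mulrC.
apply: (@le_lt_trans _ _ (n.+1%:R^-1 * (2 * #|X|%:R + 1))).
  by rewrite ler_pM2l ?invr_gt0 // lerDl.
by rewrite -ltr_pdivlMr // ltr_wpDl // mulr_ge0.
Qed.

Lemma measurable_open_pdist (A : set (pdist R X)) : open A -> measurable A.
Proof. by move=> oA; exact: sub_sigma_algebra. Qed.

Lemma measurable_pdist_set1 p : measurable [set p].
Proof.
rewrite -[X in measurable X]setCK; apply: measurableC; apply: measurable_open_pdist.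
have [l0 _ _ lo] := @metrizes_l1 R X.
apply/lo => q /= qp; exists (l1 q p).
  rewrite lt_neqAle sumr_ge0 // andbT; apply/eqP => /esym /l1_eq0.
  exact: qp.
by move=> r qr rp; move: qr; rewrite rp ltxx.
Qed.

Lemma measurable_mass x : measurable_fun [set: pdist R X] (fun p : pdist R X => p x).
Proof.
apply: (measurability _ (RGenOpens.measurableE R)) => _ [_ [a [b -> <-]]].
rewrite setTI; apply: measurable_open_pdist.
by move/continuousP : (@mass_continuous R X x); apply; exact: interval_open.
Qed.

End grid_approximation.

(** * Regularity of the predictor MDP *)

Section predictor.
Context (R : realType) (X U M : pointedFinType).
Variables (P : X -> U -> pdist R X) (c : X -> U -> R).
Variable F : pdist R X -> coding_action X U M -> M -> pdist R X.
Hypothesis hF : predictor_update P F.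
Implicit Types (p q : pdist R X) (a : coding_action X U M) (y : M) (s t : R).

Definition cost_bound : R := \sum_x \sum_u `|c x u|.

Lemma cost_bound_ge x u : `|c x u| <= cost_bound.
Proof.
rewrite /cost_bound (bigD1 x) //= (bigD1 u) //= -addrA lerDl addr_ge0 //.
  exact: sumr_ge0.
by apply: sumr_ge0 => *; exact: sumr_ge0.
Qed.

(** The L1 distance between the measures [s * p] and [t * q] of the cone over the
    simplex. *)
Definition cone_l1 s t p q : R := \sum_x `|s * p x - t * q x|.

Lemma cone_l1_11 p q : cone_l1 1 1 p q = l1 p q.
Proof. by apply: eq_bigr => x _; rewrite !mul1r. Qed.

Lemma cone_l1_ge0 s t p q : 0 <= cone_l1 s t p q.
Proof. exact: sumr_ge0. Qed.

Lemma cell_massE p (Q : quantizer X M) : \sum_y cell_mass p Q y = 1.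
Proof.
have /andP[_ /eqP <-] := pdistP p.
by rewrite (partition_big Q xpredT).
Qed.

(** The unnormalized predictor is linear in the prior, also on cells of zero mass,
    where both sides vanish whatever F is. *)
Lemma cell_mass_predictor p a y x' : cell_mass p a.1 y * F p a y x' =
  \sum_(x | a.1 x == y) P x (a.2 (a.1, y)) x' * p x.
Proof.
have := cell_mass_ge0 p a.1 y; rewrite le_eqVlt => /predU1P[m0|m0]; last first.
  by rewrite hF // mulrA mulfV ?mul1r // gt_eqF.
rewrite -m0 mul0r big1 // => x ax.
have /eqP := esym m0; rewrite psumr_eq0 => [/allP/(_ x)|z _]; last exact: pmass_ge0.
by rewrite mem_index_enum ax => /(_ isT)/eqP ->; rewrite mulr0.
Qed.

(** A stochastic matrix does not increase L1 norms. *)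
Lemma cell_predictor_dist s t p q a y :
  cone_l1 (s * cell_mass p a.1 y) (t * cell_mass q a.1 y) (F p a y) (F q a y) <=
  \sum_(x | a.1 x == y) `|s * p x - t * q x|.
Proof.
pose K x := P x (a.2 (a.1, y)).
apply: (@le_trans _ _ (\sum_x' \sum_(x | a.1 x == y) K x x' * `|s * p x - t * q x|)).
  apply: ler_sum => x' _; rewrite -!mulrA !cell_mass_predictor !mulr_sumr -sumrB.
  apply: (le_trans (ler_norm_sum _ _ _)); apply: ler_sum => x _.
  rewrite mulrCA (mulrCA t) -mulrBr normrM ger0_norm //; exact: pmass_ge0.
rewrite exchange_big; apply: ler_sum => x _ /=.
have /andP[_ /eqP K1] := pdistP (K x).
by rewrite -mulr_suml K1 mul1r.
Qed.

(** Lipschitz continuity of the degree-one homogeneous extension of V to the cone.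
    Unlike plain Lipschitz continuity on the simplex, it is preserved by the
    transition operator with the same constant, because normalizing the
    predictor amounts to moving along a ray of the cone. *)
Definition hlip (L : R) (V : pdist R X -> R) : Prop := forall s t p q,
  0 <= s -> 0 <= t -> `|s * V p - t * V q| <= L * cone_l1 s t p q.

Lemma hlip_l1 L V p q : hlip L V -> `|V p - V q| <= L * l1 p q.
Proof. by move=> /(_ 1 1 p q ler01 ler01); rewrite !mul1r cone_l1_11. Qed.

Lemma cost_hlip a : hlip cost_bound (fun p => predictor_cost c p a).
Proof.
move=> s t p q s0 t0; rewrite /predictor_cost /= !mulr_sumr -sumrB.
apply: (le_trans (ler_norm_sum _ _ _)); apply: ler_sum => x _.
rewrite !mulrA -mulrBl normrM mulrC ler_wpM2r //; exact: cost_bound_ge.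
Qed.

Lemma predictor_cost_norm p a : `|predictor_cost c p a| <= cost_bound.
Proof.
have := @cost_hlip a 1 0 p p ler01 (lexx 0); rewrite mul1r mul0r subr0.
rewrite /cone_l1; under eq_bigr => x _ do
  rewrite mul1r mul0r subr0 ger0_norm ?pmass_ge0 //.
by have /andP[_ /eqP ->] := pdistP p; rewrite mulr1.
Qed.

Definition next_value (V : pdist R X -> R) a p : R :=
  \sum_y cell_mass p a.1 y * V (F p a y).

(** The L1 norms of the restrictions to the cells of Q add up to the full L1 norm. *)
Lemma next_value_hlip L V a : 0 <= L -> hlip L V -> hlip L (next_value V a).
Proof.
move=> L0 LV s t p q s0 t0; rewrite /next_value [s * _]mulr_sumr [t * _]mulr_sumr -sumrB.
apply: (le_trans (ler_norm_sum _ _ _)).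
have -> : cone_l1 s t p q = \sum_y \sum_(x | a.1 x == y) `|s * p x - t * q x|.
  by rewrite /cone_l1 (partition_big a.1 xpredT).
rewrite mulr_sumr; apply: ler_sum => y _.
rewrite !mulrA; apply: le_trans (LV _ _ _ _ _ _) _.
- by rewrite mulr_ge0 ?cell_mass_ge0.
- by rewrite mulr_ge0 ?cell_mass_ge0.
- by rewrite ler_wpM2l // cell_predictor_dist.
Qed.

Lemma next_value_norm (V : pdist R X -> R) a p B :
  (forall q, `|V q| <= B) -> `|next_value V a p| <= B.
Proof.
move=> VB; apply: (le_trans (ler_norm_sum _ _ _)).
rewrite -[leRHS]mul1r -(cell_massE p a.1) mulr_suml; apply: ler_sum => y _.
by rewrite normrM (ger0_norm (cell_mass_ge0 _ _ _)) ler_wpM2l ?cell_mass_ge0.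
Qed.

Lemma predictor_int (V : pdist R X -> R) p a :
  \int[predictor_kernel F p a]_x V x = next_value V a p.
Proof. by rewrite Rintegral_wdirac //; exact: measurable_pdist_set1. Qed.

Lemma finitary_predictor : finitary (predictor_mdp c F).
Proof.
move=> p a; exists M, (cell_mass p a.1), (F p a); split.
- by move=> y; exact: cell_mass_ge0.
- exact: cell_massE.
- by move=> f; exact: predictor_int.
Qed.

Variable beta : R.
Hypothesis hbeta : 0 < beta < 1.

(** The fixed point of [L |-> cost_bound + beta * L]. *)
Definition lip_bound : R := cost_bound / (1 - beta).

Lemma lip_bound_ge0 : 0 <= lip_bound.
Proof.
rewrite divr_ge0 ?(le_trans (normr_ge0 _) (cost_bound_ge point point)) //.
by case/andP: hbeta => _ /ltW; rewrite subr_ge0.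
Qed.

Lemma lip_boundE : cost_bound + beta * lip_bound = lip_bound.
Proof.
by rewrite /lip_bound; field; case/andP: hbeta => _ b1; rewrite gt_eqF ?subr_gt0.
Qed.

Lemma qval_hlip V a : hlip lip_bound V ->
  hlip lip_bound (fun p => qval (predictor_mdp c F) beta V p a).
Proof.
move=> LV s t p q s0 t0; have beta0 : 0 <= beta by case/andP: hbeta => /ltW.
rewrite /qval !predictor_int /= -[X in X * cone_l1 _ _ _ _]lip_boundE.
rewrite (_ : _ - _ = (s * predictor_cost c p a - t * predictor_cost c q a) +
  beta * (s * next_value V a p - t * next_value V a q)); last by ring.
rewrite mulrDl (le_trans (ler_normD _ _)) // lerD //; first exact: cost_hlip.
rewrite normrM (ger0_norm beta0) -mulrA ler_wpM2l //.
exact: next_value_hlip lip_bound_ge0 LV _ _ _ _ s0 t0.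
Qed.

Lemma value_iterate_hlip a0 k :
  hlip lip_bound (value_iterate (predictor_mdp c F) beta a0 k).
Proof.
elim: k => [|k IH] s t p q s0 t0.
  by rewrite !mulr0 subr0 normr0 mulr_ge0 ?lip_bound_ge0 ?cone_l1_ge0.
rewrite /value_iterate iterS -/(value_iterate _ _ _ k).
set V := value_iterate _ _ _ k.
have half s' t' p' q' : 0 <= s' -> 0 <= t' ->
    s' * bellman (predictor_mdp c F) beta a0 V p' -
    t' * bellman (predictor_mdp c F) beta a0 V q' <= lip_bound * cone_l1 s' t' p' q'.
  move=> s'0 t'0; set b := greedy (predictor_mdp c F) beta a0 V q'.
  apply: le_trans (le_trans (ler_norm _) (@qval_hlip V b IH s' t' p' q' s'0 t'0)).
  have -> : bellman (predictor_mdp c F) beta a0 V q' =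
      qval (predictor_mdp c F) beta V q' b by [].
  apply: lerB; last exact: lexx.
  by apply: ler_wpM2l; [exact: s'0|exact: bellman_le].
rewrite ler_norml half // andbT lerNl opprB (le_trans (half _ _ _ _ _ _)) //.
by rewrite /cone_l1; under eq_bigr do rewrite distrC.
Qed.

End predictor.

(** * The finite models *)

Section averages.
Context d (S : measurableType d) (R : realType) (mu : probability S R).
Variables (D : set S) (mD : measurable D).

Lemma bounded_integrable (f : S -> R) (B : R) : measurable_fun setT f ->
  (forall x, `|f x| <= B) -> mu.-integrable D (EFin \o f).
Proof.
move=> mf fB; apply: measurable_bounded_integrable => //.
- by rewrite (le_lt_trans (probability_le1 mu mD)) // ltry.
- exact: measurable_funTS.
- exists B; split; rewrite ?num_real // => x Bx y _ /=.
  exact: le_trans (fB y) (ltW Bx).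
Qed.

Lemma Rintegral_sum_mulr (J : Type) (r : seq J) (f : J -> S -> R) (h : J -> R) (B : R) :
  (forall j, measurable_fun setT (f j)) -> (forall j x, `|f j x| <= B) ->
  \sum_(j <- r) (\int[mu]_(x in D) f j x) * h j =
  \int[mu]_(x in D) \sum_(j <- r) f j x * h j.
Proof.
move=> mf fB.
have mfh j : measurable_fun setT (fun x => f j x * h j).
  by apply: measurable_funM => //; exact: measurable_cst.
have int1 j : mu.-integrable D (EFin \o (fun x => f j x * h j)).
  apply: (@bounded_integrable _ (B * `|h j|)) => // x.
  by rewrite normrM ler_wpM2r.
elim: r => [|j r IH].
  rewrite big_nil; under eq_Rintegral do rewrite big_nil.
  by rewrite Rintegral_cst // mul0r.
rewrite big_cons IH; under [RHS]eq_Rintegral do rewrite big_cons.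
rewrite RintegralD //; last first.
  apply: (@bounded_integrable _ (\sum_(j <- r) B * `|h j|)).
    by apply: measurable_sum => i; exact: mfh.
  move=> x; apply: (le_trans (ler_norm_sum _ _ _)); apply: ler_sum => i _.
  by rewrite normrM ler_wpM2r.
by rewrite RintegralZr //; apply: (@bounded_integrable _ B).
Qed.

Lemma average_dist (f : S -> R) (B r e : R) : measurable_fun setT f ->
  (forall x, `|f x| <= B) -> (0 < mu D)%E ->
  (forall x, D x -> `|f x - r| <= e) ->
  `|(\int[mu]_(x in D) f x) / fine (mu D) - r| <= e.
Proof.
move=> mf fB D0 fr.
have muD : 0 < fine (mu D).
  by rewrite fine_gt0 // D0 (le_lt_trans (probability_le1 mu mD)) // ltry.
have icst k : mu.-integrable D (EFin \o (fun _ : S => k)).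
  by apply: (@bounded_integrable _ `|k|) => //; exact: measurable_cst.
have intf : mu.-integrable D (EFin \o f) by apply: (@bounded_integrable _ B).
rewrite ler_distl; apply/andP; split.
  rewrite ler_pdivlMr // -Rintegral_cst //; apply: le_Rintegral => // x /fr.
  by rewrite ler_distl => /andP[].
rewrite ler_pdivrMr // -Rintegral_cst //; apply: le_Rintegral => // x /fr.
by rewrite ler_distl => /andP[].
Qed.

End averages.

Section finite_model.
Context (R : realType) (X U M : pointedFinType).
Variables (P : X -> U -> pdist R X) (c : X -> U -> R).
Variable F : pdist R X -> coding_action X U M -> M -> pdist R X.
Hypothesis hF : predictor_update P F.
Implicit Types (p q : pdist R X) (a : coding_action X U M) (y : M).

Lemma measurable_cell_mass (Q : quantizer X M) y :
  measurable_fun setT (fun p : pdist R X => cell_mass p Q y).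
Proof.
rewrite /cell_mass; under eq_fun do rewrite big_mkcond.
apply: measurable_sum => x; case: (Q x == y); first exact: measurable_mass.
exact: measurable_cst.
Qed.

Lemma cell_mass_dist p q (Q : quantizer X M) y :
  `|cell_mass p Q y - cell_mass q Q y| <= l1 p q.
Proof.
rewrite /cell_mass -sumrB (le_trans (ler_norm_sum _ _ _)) //.
rewrite /l1 [leRHS](bigID (fun x => Q x == y)) /= lerDl.
exact: sumr_ge0.
Qed.

(** A modification of F on cells of zero mass that makes it measurable in p. *)
Definition next_state a y p : pdist R X :=
  if 0 < cell_mass p a.1 y then F p a y else point.

(** With [s = cell_mass p] and [t = cell_mass q], one has
    [s |F p - F q| <= |s F p - t F q| + |t - s| <= 2 * l1 p q]. *)
Lemma next_state_continuous a y p e : 0 < cell_mass p a.1 y -> 0 < e ->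
  exists2 r, 0 < r & forall q, l1 p q < r ->
    0 < cell_mass q a.1 y /\ l1 (F p a y) (F q a y) < e.
Proof.
set s := cell_mass p a.1 y => s0 e0.
exists (Num.min s (s * (e / 2))); first by rewrite lt_min s0 mulr_gt0 // divr_gt0.
move=> q; rewrite lt_min => /andP[qs qe]; split.
  have := le_lt_trans (cell_mass_dist p q a.1 y) qs.
  by rewrite ltr_distlC subrr => /andP[].
rewrite -(ltr_pM2l s0); set t := cell_mass q a.1 y.
have st : cone_l1 s t (F p a y) (F q a y) <= l1 p q.
  have := cell_predictor_dist hF 1 1 p q a y; rewrite !mul1r => /le_trans; apply.
  under eq_bigr do rewrite !mul1r.
  rewrite /l1 [leRHS](bigID (fun x => a.1 x == y)) /= lerDl; exact: sumr_ge0.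
apply: (@le_lt_trans _ _ (cone_l1 s t (F p a y) (F q a y) + `|t - s|)).
  have /andP[_ /eqP f1] := pdistP (F q a y).
  rewrite -[X in _ + X]mulr1 -f1 /cone_l1 /l1 !mulr_sumr -big_split /=.
  apply: ler_sum => x _; rewrite -[s in leLHS](gtr0_norm s0) -normrM.
  rewrite -[X in _ + _ * X](ger0_norm (pmass_ge0 _ _)) -normrM.
  apply: le_trans (ler_normD _ _); rewrite le_eqVlt; apply/orP; left.
  by apply/eqP; congr `|_|; ring.
rewrite (splitr e) mulrDr.
have ts : `|t - s| <= l1 p q by rewrite distrC; exact: cell_mass_dist.
by rewrite ltrD // (le_lt_trans _ qe).
Qed.

(** The Borel sigma-algebra is generated by the open sets; the preimage of an open
    set is open within the open set of predictors that charge the cell, and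
    trivial outside. *)
Lemma measurable_next_state a y : measurable_fun setT (next_state a y).
Proof.
apply: (@measurability _ _ _ _ _ _ (@open (pdist R X))); first by [].
move=> _ [V oV <-]; rewrite setTI.
pose pos := [set p : pdist R X | 0 < cell_mass p a.1 y].
have [_ _ _ lo] := @metrizes_l1 R X.
have opos : open pos.
  apply/lo => p pp; have [r r0 h] := next_state_continuous pp ltr01.
  by exists r => // q /h[].
have oFV : open (pos `&` [set p | V (F p a y)]).
  apply/lo => p [pp Vp]; have [e e0 eV] := (lo V).1 oV _ Vp.
  have [r r0 h] := next_state_continuous pp e0.
  by exists r => // q /h[pq Fe]; split => //; exact: eV.
rewrite (_ : _ @^-1` V = (pos `&` [set p | V (F p a y)]) `|`
    (~` pos `&` cst point @^-1` V)).
  apply: measurableU; first exact: measurable_open_pdist.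
  apply: measurableI; first by apply: measurableC; exact: measurable_open_pdist.
  rewrite preimage_cst; case: ifP => _; first exact: measurableT.
  exact: measurable0.
apply/seteqP; split => p; rewrite /next_state /pos /=.
  by case: ifPn => [|/negP]; [left|right].
by case=> [] [pp]; [rewrite pp|rewrite (negbTE (introN idP pp))].
Qed.

Variables (n : nat) (rho : pdist R X -> grid X n).
Hypothesis mrho : measurable_fun setT rho.
Variable kappa : probability (pdist R X) R.
Hypothesis kappa_gt0 : forall i : grid X n, (0 < kappa (bin rho i))%E.

Lemma measurable_bin i : measurable (bin rho i).
Proof. by rewrite -[bin _ _]setTI; exact: mrho. Qed.

(** Replacing F by its measurable modification changes only terms of zero weight. *)
Lemma measurable_next_value h a : measurable_fun setT (next_value F (h \o rho) a).
Proof.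
apply: measurable_sum => y.
rewrite (_ : (fun _ => _) = (fun p => cell_mass p a.1 y * (h \o rho) (next_state a y p))).
  apply: measurable_funM; first exact: measurable_cell_mass.
  apply: (@measurableT_comp _ _ _ _ _ _ h) => //.
  by apply: measurableT_comp => //; exact: measurable_next_state.
apply/funext => p; rewrite /next_state; case: ifPn => // /negbTE m0.
have := cell_mass_ge0 p a.1 y; rewrite le_eqVlt m0 orbF => /eqP <-.
by rewrite !mul0r.
Qed.

Lemma measurable_predictor_cost a :
  measurable_fun setT (fun p => predictor_cost c p a).
Proof.
apply: measurable_sum => x; apply: measurable_funM; first exact: measurable_mass.
exact: measurable_cst.
Qed.

Lemma fine_predictor_kernel p a (i : grid X n) :
  fine (predictor_kernel F p a (bin rho i)) =
  next_value F ((fun j => (j == i)%:R) \o rho) a p.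
Proof.
rewrite /predictor_kernel /= /wdirac /next_value.
under eq_bigr do rewrite diracE -EFinM.
rewrite sumEFin /=; apply: eq_bigr => y _; congr (_ * _%:R).
by congr nat_of_bool; apply/idP/eqP => [/set_mem|h]; last exact/mem_set.
Qed.

(** The expected next value in the finite model is the average over the bin of the
    expected next value, in the predictor MDP, of the function that is constant
    on bins. *)
Lemma finite_trans_sum i a (h : grid X n -> R) :
  \sum_j finite_trans F rho kappa i a j * h j =
  (\int[kappa]_(p in bin rho i) next_value F (h \o rho) a p)
    / fine (kappa (bin rho i)).
Proof.
rewrite /finite_trans.
pose f (j : grid X n) p := fine (predictor_kernel F p a (bin rho j)).
under eq_bigr do rewrite mulrAC.
rewrite -mulr_suml (@Rintegral_sum_mulr _ _ _ kappa _ (measurable_bin i) _ _ f h 1).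
- congr (_ / _); apply: eq_Rintegral => p _.
  rewrite /f; under eq_bigr do rewrite fine_predictor_kernel mulr_suml.
  rewrite exchange_big; apply: eq_bigr => y _ /=.
  rewrite (bigD1 (rho (F p a y))) //= eqxx mulr1 big1 ?addr0 // => j jr.
  by rewrite eq_sym (negbTE jr) mulr0 mul0r.
- move=> j; rewrite /f; under eq_fun do rewrite fine_predictor_kernel.
  exact: measurable_next_value.
- move=> j p; rewrite /f fine_predictor_kernel; apply: next_value_norm => q /=.
  by case: eqP; rewrite ?normr1 ?normr0.
Qed.

Lemma finitary_finite : finitary (finite_mdp c F rho kappa).
Proof.
move=> i a; exists (grid X n), (finite_trans F rho kappa i a), id; split.
- by move=> j; exact: finite_trans_ge0.
- transitivity (\sum_j finite_trans F rho kappa i a j * 1).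
    by apply: eq_bigr => j _; rewrite mulr1.
  rewrite (finite_trans_sum i a (fun=> 1)) /next_value.
  under eq_Rintegral => p _ do rewrite (eq_bigr _ (fun y _ => mulr1 _)) cell_massE.
  have mi := measurable_bin i.
  rewrite Rintegral_cst // mul1r divff // gt_eqF // fine_gt0 // kappa_gt0.
  by rewrite (le_lt_trans (probability_le1 kappa mi)) // ltry.
- by move=> f; rewrite Rintegral_wdirac.
Qed.

Lemma finite_cost_norm i a : `|finite_cost c rho kappa i a| <= cost_bound c.
Proof.
rewrite -[X in `|X|]subr0.
apply: (@average_dist _ _ _ kappa _ (measurable_bin i) _ (cost_bound c)) => //.
- exact: measurable_predictor_cost.
- by move=> p; exact: predictor_cost_norm.
- by move=> p _; rewrite subr0; exact: predictor_cost_norm.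
Qed.

End finite_model.

(** * Transfer between the predictor MDP and its finite models *)

Section approximation.
Context (R : realType) (X U M : pointedFinType).
Variables (P : X -> U -> pdist R X) (c : X -> U -> R).
Variable F : pdist R X -> coding_action X U M -> M -> pdist R X.
Hypothesis hF : predictor_update P F.
Variables (n : nat) (rho : pdist R X -> grid X n).
Hypothesis mrho : measurable_fun setT rho.
Variable kappa : probability (pdist R X) R.
Hypothesis kappa_gt0 : forall i : grid X n, (0 < kappa (bin rho i))%E.
Variable beta : R.
Hypothesis hbeta : 0 < beta < 1.
Implicit Types (p q : pdist R X) (a : coding_action X U M).

Let beta0 : 0 < beta. Proof. by case/andP: hbeta. Qed.
Let beta1 : 0 < 1 - beta. Proof. by case/andP: hbeta; rewrite subr_gt0. Qed.
Let beta_le1 : beta <= 1. Proof. by case/andP: hbeta => _ /ltW. Qed.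

Local Notation m := (predictor_mdp c F).
Local Notation mn := (finite_mdp c F rho kappa).
Local Notation L := (lip_bound c beta).

Variables (W : pdist R X -> R) (B e1 delta : R).
Hypotheses (WL : hlip L W) (WB : forall p, `|W p| <= B).
Hypothesis mesh : forall p, l1 p (grid_pdist R (rho p)) <= delta.

Let Wn (i : grid X n) : R := W (grid_pdist R i).

Lemma same_bin_l1 p q : rho p = rho q -> l1 p q <= 2 * delta.
Proof.
move=> pq; apply: le_trans (l1_triangle _ (grid_pdist R (rho p)) _) _.
by rewrite mulr2n mulrDl mul1r lerD // l1_sym pq.
Qed.

Lemma grid_value_dist p : `|Wn (rho p) - W p| <= L * delta.
Proof.
rewrite distrC; apply: le_trans (hlip_l1 _ _ WL) _.
by rewrite ler_wpM2l // (lip_bound_ge0 c hbeta).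
Qed.

(** A cost difference [2 * delta * cost_bound], plus beta times an error
    [L * delta] for sampling W on the grid and an error [2 * L * delta] for
    averaging over the bin; the sum is at most [3 * L * delta] by the choice
    of L. *)
Lemma finite_qval_dist p a :
  `|qval mn beta Wn (rho p) a - qval m beta W p a| <= 3 * (L * delta).
Proof.
have L0 := lip_bound_ge0 c hbeta.
have delta0 : 0 <= delta by apply: le_trans (mesh p); exact: sumr_ge0.
rewrite /qval predictor_int /= Rintegral_wdirac // (finite_trans_sum hF) //.
have cD : `|finite_cost c rho kappa (rho p) a - predictor_cost c p a| <=
    cost_bound c * (2 * delta).
  apply: (@average_dist _ _ _ kappa _ (measurable_bin mrho (rho p)) _
    (cost_bound c)) => //.
  - exact: measurable_predictor_cost.
  - by move=> q; exact: predictor_cost_norm.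
  - move=> q qp; apply: le_trans (hlip_l1 _ _ (cost_hlip c a)) _.
    rewrite ler_wpM2l ?same_bin_l1 //.
    by rewrite (le_trans (normr_ge0 _) (cost_bound_ge c point point)).
have vD : `|(\int[kappa]_(q in bin rho (rho p)) next_value F (Wn \o rho) a q)
      / fine (kappa (bin rho (rho p))) - next_value F W a p| <= 3 * (L * delta).
  apply: (@average_dist _ _ _ kappa _ (measurable_bin mrho (rho p)) _ B) => //.
  - exact: (measurable_next_value hF mrho).
  - by move=> q; apply: next_value_norm => q'; exact: WB.
  - move=> q qp.
    rewrite (_ : _ - _ = next_value F (fun q' => Wn (rho q') - W q') a q +
      (next_value F W a q - next_value F W a p)); last first.
      rewrite addrA; congr (_ - _); rewrite /next_value -big_split /=.
      by apply: eq_bigr => y _; rewrite -mulrDr subrK.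
    rewrite (le_trans (ler_normD _ _)) //.
    have -> : 3 * (L * delta) = L * delta + L * (2 * delta) by ring.
    rewrite lerD //; first exact: (next_value_norm F a q grid_value_dist).
    apply: le_trans (hlip_l1 _ _ (next_value_hlip hF a L0 WL)) _.
    by rewrite ler_wpM2l // same_bin_l1.
rewrite (_ : _ - _ = (finite_cost c rho kappa (rho p) a - predictor_cost c p a) +
  beta * ((\int[kappa]_(q in bin rho (rho p)) next_value F (Wn \o rho) a q)
      / fine (kappa (bin rho (rho p))) - next_value F W a p)); last by ring.
rewrite (le_trans (ler_normD _ _)) //.
apply: le_trans (lerD cD _) _.
  by rewrite normrM (gtr0_norm beta0); apply: ler_wpM2l; [exact: ltW|exact: vD].
rewrite -{2}(lip_boundE c hbeta).
have C0 : 0 <= cost_bound c * delta.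
  by rewrite mulr_ge0 // (le_trans (normr_ge0 _) (cost_bound_ge c point point)).
lra.
Qed.

Hypothesis We : forall p a, W p - qval m beta W p a <= e1.
Hypothesis We_greedy : forall p, exists a, qval m beta W p a - W p <= e1.

Let e2 : R := e1 + 4 * (L * delta).

Lemma bin_inhabited i : exists p, rho p = i.
Proof.
apply: contrapT => /forallNP h; have := kappa_gt0 i.
by rewrite (_ : bin rho i = set0) ?measure0 ?ltxx // -subset0 => p /h.
Qed.

(** The sampled W satisfies the Bellman equation of the finite model up to e2: the
    defect e1 of W, the distance [3 * L * delta] of one-step values, and the
    error [L * delta] of sampling. *)
Lemma finite_Jopt_dist i : `|Wn i - Jopt mn beta i| <= e2 / (1 - beta).
Proof.
have finn := finitary_finite c hF mrho kappa_gt0.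
have costn j a : `|mdp_cost mn j a| <= cost_bound c.
  exact: finite_cost_norm.
have WnB j : `|Wn j| <= B by exact: WB.
have We2 j a : Wn j - qval mn beta Wn j a <= e2.
  have [p <-] := bin_inhabited j.
  have := grid_value_dist p; have := finite_qval_dist p a; have := We p a.
  rewrite /e2 !ler_distl => h1 /andP[h2 h3] /andP[h4 h5]; lra.
have greedy_ex j : exists a, qval mn beta Wn j a - Wn j <= e2.
  have [p <-] := bin_inhabited j; have [a h1] := We_greedy p; exists a.
  have := grid_value_dist p; have := finite_qval_dist p a.
  rewrite /e2 !ler_distl => /andP[h2 h3] /andP[h4 h5]; lra.
have [f fP] := choice greedy_ex.
have adf : admissible (stationary R f) by apply: stationary_admissible => a.
have e20 : 0 <= e2.
  have h1 := We2 i (f i); have h2 := fP i; lra.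
rewrite ler_norml; apply/andP; split; last first.
  rewrite lerBlDr -lerBlDl.
  by apply: (Jopt_lower finn hbeta costn i _ WnB e20 We2); exists (stationary R f).
rewrite lerNl opprB lerBlDr.
apply: le_trans (Jopt_le finn hbeta costn i adf) _.
have : `|Wn i - Jbeta mn beta (stationary R f) i| <= e2 / (1 - beta).
  apply: (Jbeta_stationary_error finn hbeta costn i WnB) => j.
  rewrite ler_norml We2 andbT lerNl opprB; exact: fP.
by rewrite distrC => /(le_trans (ler_norm _)); rewrite lerBlDr.
Qed.

Variable gamma_hat : grid X n -> coding_action X U M.
Hypothesis gamma_opt : optimal_stationary mn beta gamma_hat.

(** The optimal cost of the finite model equals the one-step value of its own
    optimal action; on both sides of this equation it is replaced by W. *)
Lemma extended_policy_gap p :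
  `|W p - qval m beta W p (gamma_hat (rho p))| <=
  2 * (e2 / (1 - beta)) + 4 * (L * delta).
Proof.
have finn := finitary_finite c hF mrho kappa_gt0.
have costn j a : `|mdp_cost mn j a| <= cost_bound c.
  exact: finite_cost_norm.
set i := rho p; set a := gamma_hat i; set V := Jbeta mn beta (stationary R gamma_hat).
have VW j : `|V j - Wn j| <= e2 / (1 - beta).
  by rewrite distrC /V gamma_opt; exact: finite_Jopt_dist.
have qVW : `|qval mn beta V i a - qval mn beta Wn i a| <= e2 / (1 - beta).
  apply: le_trans (qval_dist finn hbeta i a VW) _.
  by rewrite ler_piMl // (le_trans (normr_ge0 _) (VW i)).
have VE : V i = qval mn beta V i a.
  exact: (Jbeta_stationary_fixpoint finn hbeta costn).
have := VW i; have := qVW; rewrite -VE.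
have := grid_value_dist p; have := finite_qval_dist p a.
rewrite -/i !ler_distl => /andP[h1 h2] /andP[h3 h4] /andP[h5 h6] /andP[h7 h8].
apply/andP; split; lra.
Qed.

(** The extended policy costs at most W plus its gap, and no policy costs less than
    W minus its defect. *)
Lemma extended_policy_cost_gap p :
  `|Jbeta m beta (stationary R (fun q => gamma_hat (rho q))) p - Jopt m beta p|
  <= (2 * (e2 / (1 - beta)) + 4 * (L * delta) + e1) / (1 - beta).
Proof.
set f := fun q => _.
have finm := finitary_predictor c F.
have costm q a : `|mdp_cost m q a| <= cost_bound c.
  exact: predictor_cost_norm.
have adf : admissible (stationary R f).
  apply: stationary_admissible => a.
  have ma : measurable [set i : grid X n | gamma_hat i = a] by [].
  by have := mrho measurableT ma; rewrite setTI.
have e10 : 0 <= e1.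
  by have [a h] := We_greedy p; have := We p a; lra.
have := Jbeta_stationary_error finm hbeta costm p WB extended_policy_gap.
have hopt := Jopt_le finm hbeta costm p adf.
have := Jopt_lower finm hbeta costm p _ WB e10 We.
move=> /(_ (ex_intro _ _ adf)).
rewrite -/f ler_distl => h1 /andP[h2 h3].
rewrite ger0_norm ?subr_ge0 // mulrDl; lra.
Qed.

End approximation.

Theorem mainTheorem5 (R : realType) (X U M : pointedFinType)
  (P : X -> U -> pdist R X) (c : X -> U -> R)
  (F : pdist R X -> coding_action X U M -> M -> pdist R X)
  (hF : predictor_update P F)
  (d : pdist R X -> pdist R X -> R) (hd : metrizes d)
  (rho : forall n, pdist R X -> grid X n)
  (hrho : forall n, nearest_neighbour d (rho n))
  (kappa : probability (pdist R X) R)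
  (hkappa : forall n (i : grid X n), (0 < kappa (bin (rho n) i))%E)
  (beta : R) (hbeta : 0 < beta < 1)
  (gamma_hat : forall n, grid X n -> coding_action X U M)
  (hgamma : forall n,
    optimal_stationary (finite_mdp c F (rho n) kappa) beta (gamma_hat n))
  (pi0 : pdist R X) :
  (fun n =>
     `| Jbeta (predictor_mdp c F) beta
          (stationary R (fun p : pdist R X => gamma_hat n (rho n p))) pi0
        - Jopt (predictor_mdp c F) beta pi0 |) @ \oo --> 0.
Proof.
have /andP[beta0 beta1] := hbeta.
have b1 : 0 < 1 - beta by rewrite subr_gt0.
set L := lip_bound c beta; have L0 : 0 <= L := lip_bound_ge0 c hbeta.
set C := cost_bound c.
have C0 : 0 <= C := le_trans (normr_ge0 _) (cost_bound_ge c point point).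
pose K := (4 / (1 - beta) + 2) / (1 - beta).
have K0 : 0 < K by rewrite divr_gt0 // addr_gt0 // divr_gt0.
apply/cvgr0Pnorm_lt => e e0.
pose eta := e / (2 * K); have eta0 : 0 < eta by rewrite divr_gt0 // mulr_gt0.
(* the iteration count at which value iteration is eta-accurate *)
have [k kP] : exists k, beta ^+ k * C <= eta.
  have /cvgr0Pnorm_lt/(_ _ eta0) : (fun k => beta ^+ k * C) @ \oo --> (0 : R).
    rewrite -[X in _ --> X](mul0r C); apply: cvgMl; apply: cvg_expr.
    by rewrite gtr0_norm.
  by move=> [k _ kP]; exists k; rewrite ltW // (le_lt_trans (ler_norm _)) // kP /=.
(* L + 1 rather than L, as L = 0 when the cost vanishes *)
pose delta := eta / (4 * (L + 1)).
have delta0 : 0 < delta by rewrite divr_gt0 // mulr_gt0 // ltr_wpDl.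
have Ldelta : 4 * (L * delta) <= eta.
  rewrite /delta; have -> : 4 * (L * (eta / (4 * (L + 1)))) = eta * (L / (L + 1)).
    by field; rewrite gt_eqF // ltr_wpDl.
  by rewrite ler_piMr ?(ltW eta0) // ler_pdivrMr ?ltr_wpDl // mul1r lerDl.
have := grid_mesh hd hrho delta0; apply: filterS => n mesh.
pose a0 := gamma_hat n point.
pose m := predictor_mdp c F.
pose W := value_iterate m beta a0 k.
have finm := finitary_predictor c F.
have costm q a : `|mdp_cost m q a| <= C by exact: predictor_cost_norm.
have WB p : `|W p| <= C / (1 - beta) by exact: value_iterate_norm.
have Wdist p : `|W p - value_iterate m beta a0 k.+1 p| <= eta.
  exact: le_trans (value_iterate_dist a0 finm hbeta costm k p) kP.
have We p a : W p - qval m beta W p a <= eta.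
  apply: le_trans (le_trans (ler_norm _) (Wdist p)).
  by apply: lerB; [exact: lexx|exact: bellman_le].
have We_greedy p : exists a, qval m beta W p a - W p <= eta.
  exists (greedy m beta a0 W p).
  by apply: le_trans (ler_norm _) _; rewrite distrC; exact: Wdist.
have meshle p : l1 p (grid_pdist R (rho n p)) <= delta by exact/ltW/mesh.
rewrite normr_id.
have := extended_policy_cost_gap hF (hrho n).1 (hkappa n) hbeta
  (value_iterate_hlip c hF hbeta a0 k) WB meshle We We_greedy (hgamma n) pi0.
move=> /le_lt_trans; apply.
rewrite -/L.
apply: (@le_lt_trans _ _ (eta * K)).
  have -> : eta * K = eta * (4 / (1 - beta) + 2) / (1 - beta) by rewrite mulrA.
  rewrite ler_pM2r ?invr_gt0 //.
  have : (eta + 4 * (L * delta)) / (1 - beta) <= (2 * eta) / (1 - beta).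
    by rewrite ler_pM2r ?invr_gt0 //; lra.
  have -> : eta * (4 / (1 - beta) + 2) = 2 * (2 * eta / (1 - beta)) + 2 * eta.
    by field; rewrite gt_eqF.
  lra.
have -> : eta * K = e / 2 by rewrite /eta; field; rewrite gt_eqF.
by rewrite ltr_pdivrMr // ltr_pMr // ltr1n.
Qed.
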